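(* Let $n,k$ be integers with $1\le k\le n$. Then \[ E(2n,k)=\frac{(-1)^{n-k-1}\pi^{2n}}{(2n+1)!}\sum_{i=0}^{n-k}\binom{n-i}{k}\binom{2n+1}{2i}2(2^{2i-1}-1)B_{2i}. \]
   Context: For positive integers $i_1,\dots,i_k$ with $i_1>1$, $\zeta(i_1,\dots,i_k)=\sum_{n_1>\dots>n_k\ge 1} n_1^{-i_1}\cdots n_k^{-i_k}$. For $1\le k\le n$, $E(2n,k)$ denotes the sum of $\zeta(i_1,\dots,i_k)$ over all $k$-tuples $(i_1,\dots,i_k)$ of positive even integers with $i_1+\dots+i_k=2n$. $B_m$ are the Bernoulli numbers defined by $x/(e^x-1)=\sum_{m\ge0}B_m x^m/m!$ (so $B_0=1$). *)

(* Defs.v *)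
From HB Require Import structures.
From mathcomp Require Import all_boot all_order all_algebra.
From mathcomp Require Import all_classical all_reals all_analysis.
Set Implicit Arguments.
Unset Strict Implicit.
Unset Printing Implicit Defensive.
Import Order.TTheory GRing.Theory Num.Theory.
Import numFieldNormedType.Exports.
Local Open Scope classical_set_scope.
Local Open Scope ring_scope.

(* zeta(s_1, ..., s_k), with terms indexed by the tuples m_1 > ... > m_k >= 1.
   The terms are positive, so the series is taken in the extended reals:
   it is finite exactly when the multiple series converges. *)
Definition multizeta (R : realType) (k : nat) (s : k.-tuple nat) : \bar R :=
  \esum_(m in [set m : k.-tuple nat | sorted gtn m /\ all (ltn 0) m])
     (\prod_(j < k) (tnth m j)%:R ^- (tnth s j) : R)%:E.

(* The arguments are bounded by N only to make the index type finite:
   positive integers with sum N are at most N. *)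
Definition even_multizeta_sum (R : realType) (N k : nat) : \bar R :=
  (\sum_(s : k.-tuple 'I_N.+1 |
        all (fun i : 'I_N.+1 => (0 < i)%N && ~~ odd i) s
        && (\sum_(j < k) tnth s j == N)%N)
     multizeta R (map_tuple val s))%E.

(* x / (e^x - 1) = \sum_m B_m x^m / m! for all small x <> 0 (at x = 0 the
   quotient is a removable singularity); this determines B uniquely. *)
Definition is_bernoulli (R : realType) (B : nat -> R) : Prop :=
  \forall x \near (0 : R)^',
    series (fun m => B m * x ^+ m / m`!%:R) @ \oo --> x / (expR x - 1).

(* Main.v *)
Require Import Defs.
From mathcomp Require Import all_boot all_order all_algebra.
From mathcomp Require Import all_classical all_reals all_analysis.
From mathcomp Require Import ring lra zify.
Set Implicit Arguments.
Unset Strict Implicit.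
Unset Printing Implicit Defensive.
Import Order.TTheory GRing.Theory Num.Theory.
Import numFieldNormedType.Exports.
Local Open Scope classical_set_scope.
Local Open Scope ring_scope.

(* With a_m = 1/m^2, the sum over n and k of E(2n, k) t^n s^k is
   prod_m (1 - (1 - s) a_m t) / (1 - a_m t). For the product over m <= N, clearing
   the denominator gives a convolution identity between the truncated sums and the
   elementary symmetric functions e_j(a_1, ..., a_N). As N grows, e_j tends to
   pi^(2j) / (2j+1)!: the numbers cot^2(m pi / (2N+1)) are the inverse roots of an
   explicit polynomial, and cot^2 x <= 1/x^2 <= cot^2 x + 1. The limiting
   convolution identity is inverted with the coefficients of x / sin x, i.e. the
   Bernoulli numbers. *)

(** Power series in t are represented by their coefficient sequences under [conv], and limits are
    taken one coefficient at a time, so no infinite product has to be shown convergent. As e_0 = 1,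
    the truncated identity is triangular: it gives each truncated sum from those of smaller weight,
    and its limit can be solved by convolving with an inverse sequence. That inverse is found over
    the reals through sinh: the hypothesis on B yields the expansion of x / sinh x, and the signs
    (-1)^i, put in afterwards, turn sinh x / x and x / sinh x into sin x / x and x / sin x. The
    factor 2(2^(2i-1) - 1) is the opposite of 2 - 2^(2i), which comes from 2x/(e^x - 1) - 2x/(e^(2x)
    - 1). *)

(** * Convolution of coefficient sequences *)

Definition conv {R : comNzRingType} (f g : nat -> R) (n : nat) : R :=
  \sum_(i < n.+1) f i * g (n - i)%N.

(** Coefficient n only sees terms of index at most n, so any longer truncation to a polynomial
    computes it; the ring laws of [conv] are inherited from polynomials in this way. *)
Lemma conv_poly (R : comNzRingType) (f g : nat -> R) (m n : nat) : (n < m)%N ->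
  conv f g n = ((\poly_(i < m) f i) * (\poly_(i < m) g i))`_n.
Proof.
move=> nm; rewrite coefM; apply: eq_bigr => i _; rewrite !coef_poly.
by rewrite (leq_ltn_trans _ nm) ?(leq_ltn_trans _ nm) ?leq_subr// -ltnS.
Qed.

Lemma convC (R : comNzRingType) (f g : nat -> R) : conv f g =1 conv g f.
Proof. by move=> n; rewrite !(conv_poly _ _ (ltnSn n)) mulrC. Qed.

Lemma eq_conv (R : comNzRingType) (f f' g g' : nat -> R) (n : nat) :
    (forall i, (i <= n)%N -> f i = f' i) -> (forall i, (i <= n)%N -> g i = g' i) ->
  conv f g n = conv f' g' n.
Proof.
move=> ff' gg'; apply: eq_bigr => i _.
by rewrite ff' ?gg' ?leq_subr// -ltnS.
Qed.

Lemma convA (R : comNzRingType) (f g h : nat -> R) :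
  conv f (conv g h) =1 conv (conv f g) h.
Proof.
move=> n; pose p (f : nat -> R) := \poly_(i < n.+1) f i.
have pE u i : (i <= n)%N -> u i = (p u)`_i by move=> ?; rewrite coef_poly ltnS ifT.
have -> : conv (conv f g) h n = conv (fun i => (p f * p g)`_i) h n.
  by apply: eq_conv => // i ilen; rewrite -conv_poly.
have -> : conv f (conv g h) n = conv f (fun i => (p g * p h)`_i) n.
  by apply: eq_conv => // i ilen; rewrite -conv_poly.
transitivity (p f * (p g * p h))`_n.
  by rewrite coefM; apply: eq_bigr => i _; rewrite -pE// -ltnS.
by rewrite mulrA coefM; apply: eq_bigr => i _; rewrite -[(p h)`__]pE ?leq_subr.
Qed.

Lemma conv1 (R : comNzRingType) (f : nat -> R) : conv (fun n => (n == 0)%:R) f =1 f.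
Proof.
move=> n; rewrite /conv big_ord_recl mul1r subn0 big1 ?addr0// => i _.
by rewrite mul0r.
Qed.

Lemma convDl (R : comNzRingType) (f g h : nat -> R) (n : nat) :
  conv (fun i => f i + g i) h n = conv f h n + conv g h n.
Proof. by rewrite -big_split; apply: eq_bigr => i _ /=; rewrite mulrDl. Qed.

Lemma convZl (R : comNzRingType) (c : R) (f h : nat -> R) (n : nat) :
  conv (fun i => c * f i) h n = c * conv f h n.
Proof. by rewrite /conv big_distrr; apply: eq_bigr => i _ /=; rewrite mulrA. Qed.

(** Multiplication of the generating series by t. *)
Definition shift {R : comNzRingType} (f : nat -> R) (n : nat) : R :=
  if n is n'.+1 then f n' else 0.

Lemma conv_shiftl (R : comNzRingType) (f g : nat -> R) :
  conv (shift f) g =1 shift (conv f g).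
Proof.
case=> [|n]; first by rewrite /conv big_ord1 mul0r.
by rewrite /conv big_ord_recl mul0r add0r; apply: eq_bigr.
Qed.

Lemma conv_shiftr (R : comNzRingType) (f g : nat -> R) :
  conv f (shift g) =1 shift (conv f g).
Proof.
move=> n; rewrite convC conv_shiftl.
by case: n => //= n; rewrite convC.
Qed.

(** * Elementary symmetric functions *)

Fixpoint elsym {R : comNzRingType} (a : nat -> R) (N j : nat) : R :=
  match N, j with
  | _, 0 => 1
  | 0, _.+1 => 0
  | N'.+1, j'.+1 => elsym a N' j'.+1 + a N' * elsym a N' j'
  end.

Lemma elsym0 (R : comNzRingType) (a : nat -> R) (N : nat) : elsym a N 0 = 1.
Proof. by case: N. Qed.

Lemma coef_prod_elsym (R : comNzRingType) (a : nat -> R) (N j : nat) :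
  (\prod_(m < N) (1 - a m *: 'X))`_j = (-1) ^+ j * elsym a N j.
Proof.
elim: N j => [|N IH] j.
  by rewrite big_ord0 coef1; case: j => [|j]/=; rewrite ?mulr0 ?expr0 ?mulr1.
rewrite big_ord_recr/= mulrBr mulr1 coefB -scalerAr coefZ coefMX !IH.
case: j => [|j] /=; first by rewrite elsym0 mulr0 subr0.
by rewrite exprS; ring.
Qed.

Lemma elsymZ (R : comNzRingType) (c : R) (a : nat -> R) (N j : nat) :
  elsym (fun m => c * a m) N j = c ^+ j * elsym a N j.
Proof.
elim: N j => [|N IH] [|j] /=; rewrite ?expr0 ?mulr1 ?mulr0//.
by rewrite !IH exprS; ring.
Qed.

Lemma elsym_ge0 (R : realFieldType) (a : nat -> R) (N j : nat) :
  (forall m, (m < N)%N -> 0 <= a m) -> 0 <= elsym a N j.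
Proof.
elim: N j => [|N IH] [|j] //= a0.
have {}IH j' : 0 <= elsym a N j' by apply: IH => m mN; apply: a0; rewrite ltnS ltnW.
by rewrite addr_ge0// mulr_ge0// a0.
Qed.

Lemma elsym_le (R : realFieldType) (a b : nat -> R) (N j : nat) :
  (forall m, (m < N)%N -> 0 <= a m <= b m) -> elsym a N j <= elsym b N j.
Proof.
elim: N j => [|N IH] [|j] //= ab.
have abS m : (m < N)%N -> 0 <= a m <= b m by move=> mN; apply: ab; rewrite ltnS ltnW.
have /andP[a0 aleb] := ab N (ltnSn N).
rewrite lerD ?ler_pM ?IH// elsym_ge0// => m mN.
by have /andP[] := abS _ mN.
Qed.

(** The derivative of e_(j+1) in one variable is e_j of the other variables, at most e_j of all of
    them; moving each of the N variables by at most d costs at most d N e_j. *)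
Lemma elsym_sub_le (R : realFieldType) (a b : nat -> R) (d : R) (N j : nat) :
    (forall m, (m < N)%N -> 0 <= a m <= b m) ->
    (forall m, (m < N)%N -> b m <= a m + d) -> 0 <= d ->
  elsym b N j.+1 - elsym a N j.+1 <= d * N%:R * elsym b N j.
Proof.
move=> ab bad d0; elim: N j ab bad => [|N IH] j ab bad /=; first by rewrite mulr0 mul0r subrr.
have abS m : (m < N)%N -> 0 <= a m <= b m by move=> mN; apply: ab; rewrite ltnS ltnW.
have /(_ _ abS) {}IH : forall j, (forall m, (m < N)%N -> 0 <= a m <= b m) -> _ :=
  fun j ab => IH j ab (fun m mN => bad m (ltnW mN)).
have /andP[a0 aleb] := ab N (ltnSn N).
have {}bad := bad N (ltnSn N).
have b0 i : 0 <= elsym b N i.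
  by apply: elsym_ge0 => m /abS /andP[/le_trans]; apply.
have IHj := IH j; have bj := b0 j.
have N0 : 0 <= d * N%:R by rewrite mulr_ge0.
have h1 : (b N - a N) * elsym b N j <= d * elsym b N j.
  by rewrite ler_wpM2r// lerBlDl.
case: j IHj bj h1 => [|j] IHj bj h1.
  rewrite !elsym0 in IHj h1 *.
  by rewrite -natr1 mulrDr; lra.
have h2 : a N * (elsym b N j.+1 - elsym a N j.+1) <= b N * (d * N%:R * elsym b N j).
  rewrite (le_trans (ler_wpM2l a0 (IH j)))// ler_wpM2r// mulr_ge0//.
rewrite -natr1 /=.
(* The slack left once the induction hypothesis, [h1] and [h2] are added up. *)
have h3 : 0 <= d * (b N * elsym b N j) by rewrite mulr_ge0// mulr_ge0// (le_trans a0).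
by nra.
Qed.

(** * The polynomial with inverse roots cot^2 *)

(** The zeros of sin((2N+1)x) in (0, pi/2) for m < N, numbered from 0. *)
Definition theta {R : realType} (N m : nat) : R := m.+1%:R * pi / (2 * N + 1)%:R.

Lemma big_ord_odd_even (V : nmodType) (F : nat -> V) (m : nat) :
  \sum_(i < 2 * m) F i = \sum_(j < m) F (2 * j)%N + \sum_(j < m) F (2 * j + 1)%N.
Proof.
elim: m => [|m IH]; first by rewrite !big_ord0 addr0.
by rewrite mulnS addnC addn2 !big_ord_recr /= IH addn1; rewrite -!addrA; congr (_ + _);
  rewrite addrCA.
Qed.

(** Pascal's rule, in the shape of one multiplication by 1 + i t: when f lists the real or imaginary
    parts of i^m, passing to [f i.+1] is multiplication by i. *)
Lemma binomial_sumS (R : comNzRingType) (f : nat -> R) (t : R) (n : nat) :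
  \sum_(i < n.+2) 'C(n.+1, i)%:R * f i * t ^+ i =
  \sum_(i < n.+1) 'C(n, i)%:R * f i * t ^+ i +
  t * \sum_(i < n.+1) 'C(n, i)%:R * f i.+1 * t ^+ i.
Proof.
rewrite big_ord_recl [\sum_(i < n.+1) 'C(n, i)%:R * f i * t ^+ i]big_ord_recl /= !bin0.
rewrite -addrA; congr (_ + _).
transitivity (\sum_(i < n.+1) ('C(n, i.+1)%:R * f i.+1 * t ^+ i.+1 +
                               t * ('C(n, i)%:R * f i.+1 * t ^+ i))).
  by apply: eq_bigr => i _; rewrite /bump/= add1n binS natrD exprS; ring.
rewrite big_split/= big_distrr/=; congr (_ + _).
by rewrite big_ord_recr/= bin_small// !mul0r addr0.
Qed.

(* The real and imaginary parts of i^m. *)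
Definition rei {R : pzRingType} (m : nat) : R := if odd m then 0 else (-1) ^+ m./2.
Definition imi {R : pzRingType} (m : nat) : R := if odd m then (-1) ^+ m./2 else 0.

Lemma reiS (R : pzRingType) (m : nat) : rei m.+1 = - imi m :> R.
Proof.
rewrite /rei /imi /=; case: (boolP (odd m)) => om /=; last by rewrite oppr0.
by rewrite uphalf_half om exprS mulN1r.
Qed.

Lemma imiS (R : pzRingType) (m : nat) : imi m.+1 = rei m :> R.
Proof. by rewrite /rei /imi /=; case: (boolP (odd m)) => om //=; rewrite uphalf_half (negbTE om). Qed.

(* de Moivre: compare the real and imaginary parts of (1 + i tan x)^n. *)
Lemma tan_binomial (R : realType) (x : R) (n : nat) : cos x != 0 ->
  (\sum_(i < n.+1) 'C(n, i)%:R * rei i * tan x ^+ i) * cos x ^+ n = cos (x *+ n) /\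
  (\sum_(i < n.+1) 'C(n, i)%:R * imi i * tan x ^+ i) * cos x ^+ n = sin (x *+ n).
Proof.
move=> c0; elim: n => [|n [IHc IHs]].
  by rewrite mulr0n cos0 sin0 !big_ord1 bin0 /rei /imi /=; split; ring.
have tc : tan x * cos x = sin x by rewrite /tan divfK.
have Ere : \sum_(i < n.+1) 'C(n, i)%:R * rei i.+1 * tan x ^+ i =
    - \sum_(i < n.+1) 'C(n, i)%:R * imi i * tan x ^+ i :> R.
  by rewrite -sumrN; apply: eq_bigr => i _; rewrite reiS mulrN mulNr.
have Eim : \sum_(i < n.+1) 'C(n, i)%:R * imi i.+1 * tan x ^+ i =
    \sum_(i < n.+1) 'C(n, i)%:R * rei i * tan x ^+ i :> R.
  by apply: eq_bigr => i _; rewrite imiS.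
rewrite !binomial_sumS Ere Eim mulrS cosD sinD -IHc -IHs -tc exprS.
by split; ring.
Qed.

Lemma sin_mulrn_pi (R : realType) (m : nat) : sin (pi *+ m) = 0 :> R.
Proof. by elim: m => [|m IH]; rewrite ?sin0// mulrSr sinDpi IH oppr0. Qed.

Lemma theta_itv (R : realType) (N m : nat) : (m < N)%N -> 0 < (theta N m : R) < pi / 2.
Proof.
move=> mN; rewrite /theta; apply/andP; split.
  by rewrite divr_gt0// ?mulr_gt0 ?pi_gt0// ltr0n addn1.
rewrite ltr_pdivrMr ?ltr0n ?addn1// [ltLHS]mulrC -mulrA ltr_pM2l ?pi_gt0//.
by rewrite ltr_pdivlMl// -natrM ltr_nat; lia.
Qed.

Definition cot_sqr {R : realType} (N m : nat) : R := (tan (theta N m) ^+ 2)^-1.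

Lemma tan_theta_gt0 (R : realType) (N m : nat) : (m < N)%N -> 0 < tan (theta N m : R).
Proof.
move=> mN; have /andP[th0 th2] := theta_itv R mN; rewrite /tan divr_gt0//.
  by rewrite sin_gt0_pihalf// th0.
by rewrite cos_gt0_pihalf// th2 andbT (lt_trans _ th0)// oppr_lt0 divr_gt0 ?pi_gt0.
Qed.

Lemma cos_theta_neq0 (R : realType) (N m : nat) : (m < N)%N -> cos (theta N m : R) != 0.
Proof.
move=> mN; have /andP[th0 th2] := theta_itv R mN; apply: lt0r_neq0.
by rewrite cos_gt0_pihalf// th2 andbT (lt_trans _ th0)// oppr_lt0 divr_gt0 ?pi_gt0.
Qed.

Lemma tan_theta_inj (R : realType) (N : nat) :
  {in [pred m | m < N]%N &, injective (fun m => tan (theta N m) : R)}.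
Proof.
move=> m m' /= mN m'N.
have thI i : (i < N)%N -> (theta N i : R) \in `](- (pi / 2)), (pi / 2)[.
  move=> iN; have /andP[th0 th2] := theta_itv R iN.
  by apply/andP; split; rewrite bnd_simp//; rewrite (lt_trans _ th0)// oppr_lt0 divr_gt0 ?pi_gt0.
move=> tt; suff : theta N m = theta N m' :> R.
  have n0 : (2 * N + 1)%:R^-1 != 0 :> R by rewrite invr_eq0 pnatr_eq0 addn1.
  move=> /(mulIf n0) /(mulIf (lt0r_neq0 (pi_gt0 R))) /eqP.
  by rewrite eqr_nat => /eqP[].
by apply: tan_inj => //; apply: thI.
Qed.

(** At x = [theta N m] the number sin((2N+1)x) vanishes, and by de Moivre it is a power of cos x
    times tan x times the left side at tan^2 x. Hence both sides vanish at these N distinct points,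
    and their constant terms agree. *)
Lemma prod_cot_sqr (R : realType) (N : nat) :
  \poly_(j < N.+1) ((-1) ^+ j * 'C(2 * N + 1, 2 * j + 1)%:R) =
  (2 * N + 1)%:R *: \prod_(m < N) (1 - cot_sqr N m *: 'X) :> {poly R}.
Proof.
set Q := \poly_(j < N.+1) _; set P := \prod_(m < N) _; apply/eqP; rewrite -subr_eq0.
set D := Q - _.
(* The point 0, where the constant terms are compared, is the root number N + 1 that forces a
   difference of degree at most N to be zero. *)
pose rs : seq R := 0 :: [seq tan (theta N m) ^+ 2 | m <- iota 0 N].
have hE m : (1 - cot_sqr N m *: 'X : {poly R}).[tan (theta N m) ^+ 2] =
    1 - cot_sqr N m * tan (theta N m) ^+ 2 by rewrite !hornerE.
have szP : (size P <= N.+1)%N.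
  rewrite (leq_trans (size_prod_leq _ _))//=.
  have : (\sum_(m < N) size (1 - cot_sqr N m *: 'X : {poly R})%R <= \sum_(m < N) 2)%N.
    apply: leq_sum => m _; rewrite (leq_trans (size_polyD _ _))// geq_max.
    by rewrite size_poly1 size_polyN/= (leq_trans (size_scale_leq _ _))// size_polyX.
  rewrite sum_nat_const card_ord => sz; rewrite leq_subLR.
  by rewrite addnS ltnS (leq_trans sz)// muln2 -addnn.
rewrite (@roots_geq_poly_eq0 _ D rs)//.
- apply/allP => y; rewrite inE => /predU1P[->|/mapP[m]].
    rewrite /root hornerD hornerN hornerZ !horner_coef0 coef_poly /= muln0 bin1.
    by rewrite coef_prod_elsym elsym0 expr0 !mulr1 mul1r subrr.
  rewrite mem_iota add0n /= => mN ->.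
  have t0 := tan_theta_gt0 R mN.
  rewrite /root hornerD hornerN hornerZ horner_prod.
  rewrite [X in _ * X](_ : _ = 0) ?mulr0 ?subr0; last first.
    rewrite (bigD1 (Ordinal mN))//= hE /cot_sqr mulVf ?subrr ?mul0r//.
    by rewrite expf_neq0// lt0r_neq0.
  have [_] := tan_binomial (2 * N + 1) (cos_theta_neq0 R mN).
  have -> : theta N m *+ (2 * N + 1) = pi *+ m.+1 :> R.
    by rewrite -mulr_natr /theta divfK ?pnatr_eq0 ?addn1// mulr_natl.
  rewrite sin_mulrn_pi => /eqP; rewrite mulf_eq0 expf_eq0 (negbTE (cos_theta_neq0 R mN)).
  rewrite andbF orbF => /eqP S0.
  suff : tan (theta N m) * Q.[tan (theta N m) ^+ 2] = 0.
    by move/eqP; rewrite mulf_eq0 gt_eqF.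
  rewrite -{}[RHS]S0 (_ : (2 * N + 1).+1 = 2 * N.+1)%N; last by lia.
  rewrite (big_ord_odd_even (fun i => 'C(2 * N + 1, i)%:R * imi i * _ ^+ i)) [X in _ = X + _]big1 ?add0r; last first.
    by move=> j _; rewrite /imi oddM /= mulr0 mul0r.
  rewrite horner_poly big_distrr/=; apply: eq_bigr => j _.
  have -> : imi (2 * j + 1) = (-1) ^+ j :> R.
    by rewrite /imi addn1 mul2n /= odd_double uphalf_double.
  by rewrite -exprM exprD expr1; ring.
- rewrite /rs /= map_inj_in_uniq ?iota_uniq ?andbT; last first.
    move=> m m'; rewrite !mem_iota !add0n /= => mN m'N /eqP.
    rewrite eqrXn2 ?ltW ?tan_theta_gt0// => /eqP; exact: tan_theta_inj.
  apply/mapP => -[m]; rewrite mem_iota add0n/= => mN t0.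
  by have := exprn_gt0 2 (tan_theta_gt0 R mN); rewrite -t0 ltxx.
- rewrite /rs /= size_map size_iota /D (leq_trans (size_polyD _ _))//.
  rewrite geq_max size_poly size_polyN (leq_trans (size_scale_leq _ _))//.
Qed.

(** * Limit of the elementary symmetric functions of 1/m^2 *)

Lemma ler_sin (R : realType) (x : R) : 0 < x -> sin x <= x.
Proof.
move=> x0; have [|c _] := MVT x0 (fun y _ => is_derive_sin y).
  by apply: continuous_subspaceT => y; exact: continuous_sin.
by rewrite sin0 !subr0 => ->; rewrite ler_piMl ?cos_le1// ltW.
Qed.

Lemma ler_tan (R : realType) (x : R) : 0 < x < pi / 2 -> x <= tan x.
Proof.
move=> /andP[x0 x2].
have cos0 y : y \in `[0, x] -> 0 < cos y.
  move=> /[!in_itv]/= /andP[y0 yx]; rewrite cos_gt0_pihalf// (le_lt_trans yx)// andbT.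
  by rewrite (lt_le_trans _ y0)// oppr_lt0 divr_gt0 ?pi_gt0.
have [||c] := @MVT R tan (fun y => (cos y) ^- 2) 0 x x0.
- move=> y /subset_itv_oo_cc /cos0 c0; apply: is_derive_tan.
  by rewrite lt0r_neq0.
- apply: derivable_within_continuous => y /cos0 c0; apply: derivable_tan.
  by rewrite lt0r_neq0.
move=> /subset_itv_oo_cc /cos0 c0; rewrite tan0 !subr0 => ->.
by rewrite ler_peMl ?(ltW x0)// invf_ge1 ?exprn_gt0// exprn_ile1 ?cos_le1// ltW.
Qed.

Lemma elsym_cot_sqr (R : realType) (N j : nat) :
  elsym (@cot_sqr R N) N j = 'C(2 * N + 1, 2 * j + 1)%:R / (2 * N + 1)%:R.
Proof.
have n0 : (2 * N + 1)%:R != 0 :> R by rewrite pnatr_eq0 addn1.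
have := congr1 (fun p : {poly R} => p`_j) (prod_cot_sqr R N).
rewrite coefZ coef_prod_elsym coef_poly mulrCA ltnS.
case: leqP => [jN|Nj] E.
  have s0 : (-1) ^+ j != 0 :> R by rewrite signr_eq0.
  by rewrite (mulfI s0 E) mulrAC divff// mul1r.
move/eqP: E; rewrite bin_small ?mul0r; last by lia.
by rewrite eq_sym !mulf_eq0 signr_eq0 (negbTE n0)/= => /eqP.
Qed.

Lemma inv_odd_cvg0 (R : realType) : (fun N => (2 * N + 1)%:R^-1 : R) @ \oo --> (0 : R).
Proof.
apply: (@squeeze_cvgr _ _ _ _ (fun=> 0) (@harmonic R)); last exact: cvg_harmonic.
  near=> N; rewrite invr_ge0 ler0n/= lef_pV2 ?posrE ?ltr0n ?addn1//.
  by rewrite ler_nat; lia.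
exact: cvg_cst.
Unshelve. all: by end_near. Qed.

Lemma bin_odd_cvg (R : realType) (k : nat) :
  (fun N => 'C(2 * N + 1, k)%:R / (2 * N + 1)%:R ^+ k : R) @ \oo --> (k`!%:R^-1 : R).
Proof.
elim: k => [|k IH].
  have -> : 0`!%:R^-1 = 1 :> R by rewrite fact0 invr1.
  by apply: cvg_near_cst; near=> N; rewrite bin0 mulr1.
have -> : k.+1`!%:R^-1 = k`!%:R^-1 * ((1 - k%:R * 0) * k.+1%:R^-1) :> R.
  by rewrite mulr0 subr0 mul1r factS natrM invfM mulrC.
have h : (fun N => 'C(2 * N + 1, k)%:R / (2 * N + 1)%:R ^+ k *
    ((1 - k%:R * (2 * N + 1)%:R^-1) * k.+1%:R^-1) : R) @ \oo -->
    k`!%:R^-1 * ((1 - k%:R * 0) * k.+1%:R^-1 : R).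
  apply: cvgM IH _; apply: cvgM _ (cvg_cst _); apply: cvgB (cvg_cst _) _.
  by apply: cvgM (cvg_cst _) _; exact: inv_odd_cvg0.
apply: cvg_trans h.
apply: near_eq_cvg; near=> N.
have n0 : (2 * N + 1)%:R != 0 :> R by rewrite pnatr_eq0 addn1.
have k0 : k.+1%:R != 0 :> R by rewrite pnatr_eq0.
(* For k > 2N + 1 both binomials vanish, which accounts for the truncated subtraction in
   [mul_bin_left]. *)
have -> : 'C(2 * N + 1, k.+1)%:R =
    'C(2 * N + 1, k)%:R * ((2 * N + 1)%:R - k%:R) / k.+1%:R :> R.
  apply: (mulIf k0); rewrite divfK// -natrM mulnC mul_bin_left natrM mulrC.
  case: (leqP k (2 * N + 1)) => kn; first by rewrite natrB.
  by rewrite bin_small// !mul0r.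
rewrite exprS; move: (2 * N + 1)%:R n0 => n n0.
have nk0 : n ^+ k != 0 by rewrite expf_neq0.
by field; rewrite nk0 n0 nat1r.
Unshelve. all: by end_near. Qed.

Definition inv_sqr {R : realType} (m : nat) : R := (m.+1%:R ^+ 2)^-1.

(** Uniformity in N is the point: with d of order 1/N^2, the error d N e_j of [elsym_sub_le] becomes
    O(1/N). *)
Lemma elsym_inv_sqr_le (R : realType) (N j : nat) : elsym (@inv_sqr R) N j <= 2 ^+ j :> R.
Proof.
have sum_le M : \sum_(m < M) inv_sqr m <= (2 : R).
  case: M => [|M]; first by rewrite big_ord0.
  (* The term 1/M makes the induction work, since 1/(M+1)^2 <= 1/M - 1/(M+1). *)
  suff : \sum_(m < M.+1) inv_sqr m <= 2 - M.+1%:R^-1 :> R.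
    by move=> /le_trans; apply; rewrite gerBl invr_ge0.
  elim: M => [|M IH].
    by rewrite big_ord1 /inv_sqr expr1n invr1; lra.
  rewrite big_ord_recr/= (le_trans (lerD IH (lexx _)))// /inv_sqr.
  have x0 : 0 < M.+1%:R :> R by [].
  rewrite -(natr1 M.+1); set x := M.+1%:R in x0 *.
  rewrite -subr_ge0 [X in 0 <= X](_ : _ = (x * (x + 1) ^+ 2)^-1); last first.
    by field; lra.
  by rewrite invr_ge0 mulr_ge0 ?ltW// exprn_gt0//; lra.
elim: j N => [|j IH] N; first by rewrite elsym0.
suff : elsym (@inv_sqr R) N j.+1 <= 2 ^+ j * \sum_(m < N) inv_sqr m :> R.
  by move=> /le_trans; apply; rewrite exprSr ler_wpM2l// exprn_ge0.
elim: N => [|N IHN]; first by rewrite big_ord0 mulr0.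
rewrite big_ord_recr/= mulrDr lerD// mulrC ler_wpM2r//.
by rewrite /inv_sqr invr_ge0 exprn_ge0.
Qed.

(* sin x <= x <= tan x turns into cot^2 x <= 1/x^2 <= cot^2 x + 1 at x = theta N m. *)
Lemma inv_sqr_itv (R : realType) (N m : nat) (d := (pi / (2 * N + 1)%:R) ^+ 2 : R) :
  (m < N)%N -> 0 <= d * cot_sqr N m <= inv_sqr m /\ inv_sqr m <= d * cot_sqr N m + d.
Proof.
move=> mN; have /andP[th0 th2] := theta_itv R mN.
have n0 : (2 * N + 1)%:R != 0 :> R by rewrite pnatr_eq0 addn1.
have d0 : 0 <= d by rewrite sqr_ge0.
have inv_sqrE : inv_sqr m = d * (theta N m ^+ 2)^-1.
  have := lt0r_neq0 (pi_gt0 R); have : m.+1%:R != 0 :> R by rewrite pnatr_eq0.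
  rewrite /inv_sqr /d /theta; move: (2 * N + 1)%:R m.+1%:R pi n0 => n m' p n0 m0 p0.
  by field; rewrite m0 n0 p0.
have t0 := tan_theta_gt0 R mN; have c0 := cos_theta_neq0 R mN.
split.
  rewrite inv_sqrE mulr_ge0//=; last by rewrite /cot_sqr invr_ge0 sqr_ge0.
  rewrite ler_wpM2l// /cot_sqr lef_pV2 ?posrE ?exprn_gt0//.
  by rewrite lerXn2r ?nnegrE ?ler_tan ?th0 ?th2 ?(ltW t0) ?(ltW th0).
rewrite inv_sqrE -[X in _ <= _ + X]mulr1 -mulrDr ler_wpM2l//.
have s0 : 0 < sin (theta N m) :> R by rewrite sin_gt0_pihalf// th0.
have -> : cot_sqr N m + 1 = (sin (theta N m) ^+ 2)^-1 :> R.
  rewrite -[RHS]mul1r -[in RHS](cos2Dsin2 (theta N m)) /cot_sqr /tan.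
  by field; rewrite c0 lt0r_neq0.
by rewrite lef_pV2 ?posrE ?exprn_gt0// lerXn2r ?nnegrE ?(ltW s0) ?(ltW th0)// ler_sin.
Qed.

(* The value of zeta(2, ..., 2) with j arguments. *)
Definition zeta2 {R : realType} (j : nat) : R := pi ^+ (2 * j) / (2 * j + 1)`!%:R.

Lemma elsym_inv_sqr_cvg (R : realType) (j : nat) :
  (fun N => elsym (@inv_sqr R) N j : R) @ \oo --> (zeta2 j : R).
Proof.
pose d N : R := (pi / (2 * N + 1)%:R) ^+ 2.
pose b N : R := elsym (fun m => d N * cot_sqr N m) N j.
have b_cvg : b @ \oo --> (zeta2 j : R).
  apply: cvg_trans; last exact: cvgM (cvg_cst (pi ^+ (2 * j))) (@bin_odd_cvg R (2 * j + 1)).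
  apply: near_eq_cvg; near=> N.
  have n0 : (2 * N + 1)%:R != 0 :> R by rewrite pnatr_eq0 addn1.
  rewrite /b elsymZ elsym_cot_sqr /d -exprM expr_div_n /=.
  move: (2 * N + 1)%:R n0 => n n0.
  have -> : n ^+ (2 * j + 1) = n ^+ (2 * j) * n by rewrite addn1 exprSr.
  by field; rewrite n0 expf_neq0.
(* [elsym_sub_le] only speaks of positive indices; e_0 is constant. *)
case: j @b b_cvg => [|j] b b_cvg.
  apply: cvg_trans b_cvg; apply: near_eq_cvg; near=> N.
  by rewrite /b !elsym0.
(* The gap is at most d N e_j <= pi^2 2^j N/(2N+1)^2, and N/(2N+1)^2 <= 1/(N+1). *)
apply: (@squeeze_cvgr _ _ _ _ b (fun N => b N + pi ^+ 2 * 2 ^+ j * harmonic N)).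
- near=> N; apply/andP; split.
    by apply: elsym_le => m mN; have [] := inv_sqr_itv R mN.
  rewrite -lerBlDl (@le_trans _ _ (d N * N%:R * elsym (@inv_sqr R) N j))//.
    apply: elsym_sub_le => [m mN|m mN|]; last by rewrite sqr_ge0.
      by have [] := inv_sqr_itv R mN.
    by have [] := inv_sqr_itv R mN.
  rewrite /d expr_div_n -[leRHS]mulrA.
  have -> (x y z t : R) : x / y * z * t = x * (t * (z / y)) by ring.
  rewrite ler_wpM2l ?sqr_ge0// ler_pM ?elsym_inv_sqr_le//.
    by apply: elsym_ge0 => m _; rewrite invr_ge0 sqr_ge0.
  rewrite /= -[leRHS]div1r ler_pdivlMr// mulrAC ler_pdivrMr ?exprn_gt0 ?ltr0n ?addn1// mul1r.
  by rewrite -natrM -natrX ler_nat; nia.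
- exact: b_cvg.
rewrite -[X in _ --> X]addr0 -[X in _ --> _ + X](mulr0 (pi ^+ 2 * 2 ^+ j)).
by apply: cvgD b_cvg _; apply: cvgM (cvg_cst _) (@cvg_harmonic R).
Unshelve. all: by end_near. Qed.

(** * Asymptotic expansions and the coefficients of x / sinh x *)

(* Asymptotic expansion at 0; unlike a power series, it can be multiplied by
   manipulating finite sums only. *)
Definition expands {R : realType} (f : R -> R) (a : nat -> R) : Prop :=
  forall n, exists C, \forall x \near (0 : R)^',
    `|f x - \sum_(i < n) a i * x ^+ i| <= C * `|x| ^+ n.

(** Convergence at a single point y > 0 bounds the terms |a_m| y^m by some M; for |x| < y/2 the tail
    from n on is then dominated by a geometric series of ratio r = |x|/y <= 1/2. *)
Lemma series_expands (R : realType) (f : R -> R) (a : nat -> R) :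
    (\forall x \near (0 : R)^', series (fun m => a m * x ^+ m) @ \oo --> f x) ->
  expands f a.
Proof.
move=> /nbhs_ballP[e /= e0 fa] n.
have {}fa x : x != 0 -> `|x| < e -> series (fun m => a m * x ^+ m) @ \oo --> f x.
  by move=> x0 xe; apply: fa => //; rewrite -ball_normE /= sub0r normrN.
pose y := e / 2.
have y0 : 0 < y by rewrite divr_gt0.
have ye : y < e by rewrite ltr_pdivrMr// ltr_pMr// ltr1n.
have [M M0 aM] : exists2 M, 0 <= M & forall m, `|a m| * y ^+ m <= M.
  have /cvg_series_cvg_0/cvgP/cvg_seq_bounded : cvgn (series (fun m => a m * y ^+ m)).
    by apply/cvg_ex; exists (f y); apply: fa; rewrite ?gt_eqF ?gtr0_norm.
  case=> M [_ /(_ (M + 1))]; rewrite ltrDl ltr01 => /(_ isT) bM.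
  have h m : `|a m| * y ^+ m <= M + 1.
    by have := bM m I; rewrite /= normrM normrX (gtr0_norm y0).
  by exists (M + 1) => //; rewrite (le_trans _ (h 0%N))// mulr_ge0// exprn_ge0// ltW.
exists (2 * M / y ^+ n); near=> x.
have x0 : x != 0 by near: x; exact: nbhs_dnbhs_neq.
have xy : `|x| < y / 2.
  near: x; apply: dnbhs0_lt; by rewrite divr_gt0.
pose r := `|x| / y.
have r0 : 0 <= r by rewrite divr_ge0// ltW.
have r2 : r <= 2^-1 by rewrite ler_pdivrMr// mulrC ltW.
have fx := fa x x0 (lt_trans xy (lt_trans (_ : y / 2 < y) ye)).
have {}fx : series (fun m => a m * x ^+ m) @ \oo --> f x.
  by apply: fx; rewrite ltr_pdivrMr// ltr_pMr// ltr1n.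
have am m : `|a m * x ^+ m| <= M * r ^+ m.
  rewrite normrM normrX /r expr_div_n mulrCA -ler_pdivrMl ?exprn_gt0 ?normr_gt0//.
  rewrite mulrCA mulVf ?mulr1 ?expf_neq0 ?normr_eq0//.
  by rewrite ler_pdivlMr ?exprn_gt0.
have seriesE k : series (fun m => a m * x ^+ m) k = \sum_(i < k) a i * x ^+ i.
  by rewrite /series/= big_mkord.
(* The bound grows by 2 M r^(n+k) (1 - r) from k to k + 1, at least the new term M r^(n+k) because r
   <= 1/2. *)
have tail k : `|\sum_(i < n + k) a i * x ^+ i - \sum_(i < n) a i * x ^+ i| <=
    2 * M * r ^+ n * (1 - r ^+ k).
  elim: k => [|k IH]; first by rewrite addn0 subrr normr0 expr0 subrr mulr0.
  rewrite addnS big_ord_recr/= addrAC (le_trans (ler_normD _ _))//.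
  apply: le_trans (lerD IH (am _)) _.
  have : 0 <= M * r ^+ n * r ^+ k by rewrite !mulr_ge0 ?exprn_ge0.
  by rewrite exprD exprS; nra.
have cvg_tail : (fun k => `|\sum_(i < k) a i * x ^+ i - \sum_(i < n) a i * x ^+ i|)
    @ \oo --> `|f x - \sum_(i < n) a i * x ^+ i|.
  apply: cvg_norm; apply: cvgB (cvg_cst _).
  by under eq_fun do rewrite -seriesE.
apply: (cvgr_to_le cvg_tail); near=> k.
have nk : (n <= k)%N by near: k; exact: nbhs_infty_ge.
rewrite -(subnKC nk) (le_trans (tail _))//.
have -> : 2 * M / y ^+ n * `|x| ^+ n = 2 * M * r ^+ n.
  by rewrite /r [in RHS]expr_div_n -[LHS]mulrA [X in _ * X = _]mulrC.
by rewrite ler_piMr// ?gerBl ?mulr_ge0 ?exprn_ge0.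
Unshelve. all: by end_near. Qed.

(** At the first index n of disagreement, d |x|^n <= (C + C') |x|^(n+1) with d = |a_n - b_n| > 0,
    which fails for small x. *)
Lemma expands_unique (R : realType) (f : R -> R) (a b : nat -> R) :
  expands f a -> expands f b -> a =1 b.
Proof.
move=> fa fb n; elim/ltn_ind: n => n IH.
have [C hC] := fa n.+1; have [C' hC'] := fb n.+1.
apply/eqP; rewrite -subr_eq0 -normr_eq0; apply/negPn/negP => d0.
have {}d0 : 0 < `|a n - b n| by rewrite lt_def d0 normr_ge0.
set d := `|_| in d0.
have K0 : 0 < `|C + C'| + 1 by rewrite ltr_wpDl.
have : \forall x \near (0 : R)^', False; last first.
  by move=> /filter_ex[].
near=> x.
have x0 : x != 0 by near: x; exact: nbhs_dnbhs_neq.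
have xd : `|x| < d / (`|C + C'| + 1) by near: x; apply: dnbhs0_lt; rewrite divr_gt0.
have h1 : `|f x - \sum_(i < n.+1) a i * x ^+ i| <= C * `|x| ^+ n.+1 by near: x.
have h2 : `|f x - \sum_(i < n.+1) b i * x ^+ i| <= C' * `|x| ^+ n.+1 by near: x.
have : d * `|x| ^+ n <= (C + C') * `|x| ^+ n.+1.
  have -> : d * `|x| ^+ n = `|(a n - b n) * x ^+ n| by rewrite normrM normrX.
  rewrite [leRHS]mulrDl [leRHS]addrC; apply: le_trans (lerD h2 h1).
  apply: le_trans (ler_normB _ _); rewrite !big_ord_recr/=.
  rewrite [\sum_(i < n) a i * _](eq_bigr (fun i : 'I_n => b i * x ^+ i)); last first.
    by move=> i _; rewrite IH.
  by rewrite le_eqVlt; apply/orP; left; apply/eqP; congr `|_|; ring.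
rewrite exprS mulrA ler_pM2r ?exprn_gt0 ?normr_gt0// leNgt => /negP; apply.
rewrite ltr_pdivlMr// in xd; apply: le_lt_trans xd; rewrite mulrC ler_wpM2l//.
by rewrite (le_trans (ler_norm _))// lerDl.
Unshelve. all: by end_near. Qed.

Lemma ler_norm_horner (R : realType) (p : {poly R}) (x : R) : `|x| <= 1 ->
  `|p.[x]| <= \sum_(i < size p) `|p`_i|.
Proof.
move=> x1; rewrite horner_coef (le_trans (ler_norm_sum _ _ _))//.
apply: ler_sum => i _; rewrite normrM ler_piMr// normrX exprn_ile1//.
Qed.

(** Replace f and g by their polynomial truncations p and q: products involving a remainder are
    O(x^n), and p q has the coefficients of [conv a b] below degree n, the rest being a multiple of
    x^n. *)
Lemma expandsM (R : realType) (f g : R -> R) (a b : nat -> R) :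
  expands f a -> expands g b -> expands (fun x => f x * g x) (conv a b).
Proof.
move=> fa gb n; have [C hC] := fa n; have [C' hC'] := gb n.
pose p := \poly_(i < n) a i; pose q := \poly_(i < n) b i.
pose nrm (p : {poly R}) := \sum_(i < size p) `|p`_i|.
(* One summand for each term of the error decomposition below; [nrm] bounds a polynomial on |x| <=
   1. *)
exists (`|C| * `|C'| + `|C| * nrm q + nrm p * `|C'| + nrm (drop_poly n (p * q))).
near=> x.
have x1 : `|x| <= 1 by apply: ltW; near: x; exact: dnbhs0_lt.
have h1 : `|f x - \sum_(i < n) a i * x ^+ i| <= C * `|x| ^+ n by near: x.
have h2 : `|g x - \sum_(i < n) b i * x ^+ i| <= C' * `|x| ^+ n by near: x.
rewrite -horner_poly -/p in h1; rewrite -horner_poly -/q in h2.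
have -> : \sum_(i < n) conv a b i * x ^+ i = (take_poly n (p * q)).[x].
  by rewrite horner_poly; apply: eq_bigr => i _; rewrite (conv_poly _ _ (ltn_ord i)).
have xn0 : 0 <= `|x| ^+ n by rewrite exprn_ge0.
have {}h1 : `|f x - p.[x]| <= `|C| * `|x| ^+ n.
  by rewrite (le_trans h1)// ler_wpM2r// ler_norm.
have {}h2 : `|g x - q.[x]| <= `|C'| * `|x| ^+ n.
  by rewrite (le_trans h2)// ler_wpM2r// ler_norm.
have pq : p.[x] * q.[x] =
    (take_poly n (p * q)).[x] + (drop_poly n (p * q)).[x] * x ^+ n.
  by rewrite -hornerM -{1}(poly_take_drop n (p * q)) hornerD hornerM hornerXn.
have -> : f x * g x - (take_poly n (p * q)).[x] =
    (f x - p.[x]) * (g x - q.[x]) + (f x - p.[x]) * q.[x] + p.[x] * (g x - q.[x]) +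
    (drop_poly n (p * q)).[x] * x ^+ n.
  have -> : (take_poly n (p * q)).[x] =
      p.[x] * q.[x] - (drop_poly n (p * q)).[x] * x ^+ n by rewrite pq addrK.
  by ring.
rewrite (le_trans (ler_normD _ _))// [leRHS]mulrDl lerD//.
  rewrite (le_trans (ler_normD _ _))// [leRHS]mulrDl lerD//.
    rewrite (le_trans (ler_normD _ _))// [leRHS]mulrDl lerD//.
    - rewrite normrM (le_trans (ler_pM (normr_ge0 _) (normr_ge0 _) h1 h2))// mulrACA mulrA.
      by rewrite ler_piMr ?mulr_ge0// exprn_ile1.
    - rewrite normrM mulrAC ler_pM//; exact: ler_norm_horner.
  rewrite normrM -mulrA ler_pM//; exact: ler_norm_horner.
rewrite normrM normrX ler_wpM2r//; exact: ler_norm_horner.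
Unshelve. all: by end_near. Qed.

Lemma expands_id (R : realType) : expands (fun x : R => x) (fun m => (m == 1)%:R).
Proof.
apply: series_expands; near=> x; apply: cvg_near_cst; near=> n.
have n2 : (2 <= n)%N by near: n; exact: nbhs_infty_ge.
rewrite /series /= big_mkord -(subnKC n2) big_ord_recl big_ord_recl big1.
  by rewrite /= mul0r add0r mul1r expr1 addr0.
by move=> i _; rewrite mul0r.
Unshelve. all: by end_near. Qed.

Lemma cvg_exp_series (R : realType) (x : R) :
  series (fun m => (m`!%:R)^-1 * x ^+ m) @ \oo --> expR x.
Proof.
rewrite (_ : (fun m => _) = exp_coeff x); first exact: is_cvg_series_exp_coeff.
by apply/funext => m; rewrite /exp_coeff mulrC.
Qed.

Lemma expands_sinh (R : realType) :
  expands (fun x : R => (expR x - expR (- x)) / 2)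
    (fun m => if odd m then (m`!%:R)^-1 else 0).
Proof.
apply: series_expands; near=> x.
have h : (fun n => (series (fun m => (m`!%:R)^-1 * x ^+ m) n -
    series (fun m => (m`!%:R)^-1 * (- x) ^+ m) n) * 2^-1) @ \oo -->
    (expR x - expR (- x)) / 2.
  by apply: cvgM _ (cvg_cst _); apply: cvgB; exact: cvg_exp_series.
apply: cvg_trans h; apply: near_eq_cvg; near=> n => /=.
rewrite /series /= -sumrB big_distrl /=; apply: eq_bigr => m _.
rewrite exprNn -signr_odd; case: odd => /=.
  by rewrite expr1; move: (m`!%:R^-1 : R) => c; field.
by rewrite expr0 mul1r subrr !mul0r.
Unshelve. all: by end_near. Qed.

(* The function is x / sinh x; the two terms come from
   1 / (e^x - 1) - 1 / (e^(2x) - 1) = e^x / (e^(2x) - 1). *)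
Lemma expands_bernoulli (R : realType) (B : nat -> R) : is_bernoulli B ->
  expands (fun x => 2 * (x / (expR x - 1)) - 2 * x / (expR (2 * x) - 1))
    (fun m => (2 - 2 ^+ m) * B m / m`!%:R).
Proof.
move=> hB; have hB2 : \forall x \near (0 : R)^',
    series (fun m => B m * (2 * x) ^+ m / m`!%:R) @ \oo --> 2 * x / (expR (2 * x) - 1).
  move: hB => /nbhs_ballP[e /= e0 fa]; near=> x.
  have x0 : x != 0 by near: x; exact: nbhs_dnbhs_neq.
  apply: fa; last by rewrite /= mulf_neq0.
  rewrite -ball_normE /= sub0r normrN normrM gtr0_norm// mulrC -ltr_pdivlMr//.
  by near: x; apply: dnbhs0_lt; rewrite divr_gt0.
apply: series_expands; near=> x.
have h1 : series (fun m => B m * x ^+ m / m`!%:R) @ \oo --> x / (expR x - 1) by near: x.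
have h2 : series (fun m => B m * (2 * x) ^+ m / m`!%:R) @ \oo -->
  2 * x / (expR (2 * x) - 1) by near: x.
have h : (fun n => 2 * series (fun m => B m * x ^+ m / m`!%:R) n -
    series (fun m => B m * (2 * x) ^+ m / m`!%:R) n) @ \oo -->
    2 * (x / (expR x - 1)) - 2 * x / (expR (2 * x) - 1).
  by apply: cvgB h2; apply: cvgM (cvg_cst _) h1.
apply: cvg_trans h; apply: near_eq_cvg; near=> n => /=.
rewrite /series /= big_distrr /= -sumrB; apply: eq_bigr => m _.
by rewrite exprMn; ring.
Unshelve. all: by end_near. Qed.

Lemma expands_near (R : realType) (f g : R -> R) (a : nat -> R) :
  (\forall x \near (0 : R)^', f x = g x) -> expands f a -> expands g a.
Proof.
move=> fg fa n; have [C hC] := fa n; exists C; near=> x.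
by rewrite -(_ : f x = g x); near: x.
Unshelve. all: by end_near. Qed.

(** Compare the coefficients of x^(2n+1) in (x / sinh x) sinh x = x. As sinh is odd, only the
    even-indexed coefficients of the first factor contribute. *)
Lemma conv_bernoulli (R : realType) (B : nat -> R) (n : nat) : is_bernoulli B ->
  conv (fun i => (2 - 2 ^+ (2 * i)) * B (2 * i)%N / (2 * i)`!%:R)
       (fun j => ((2 * j + 1)`!%:R)^-1) n = (n == 0)%:R.
Proof.
move=> hB; have := expandsM (expands_bernoulli hB) (@expands_sinh R).
have prod_eq : \forall x \near (0 : R)^',
    (2 * (x / (expR x - 1)) - 2 * x / (expR (2 * x) - 1)) *
    ((expR x - expR (- x)) / 2) = x.
  near=> x; have x0 : x != 0 by near: x; exact: nbhs_dnbhs_neq.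
  rewrite expRN mulr_natl expRM_natl.
  have E0 : expR x != 0 by rewrite gt_eqF ?expR_gt0.
  have E1 : expR x - 1 != 0.
    by rewrite subr_eq0 -expR0; apply: contra x0 => /eqP/expR_inj->.
  have E2 : expR x + 1 != 0 by rewrite gt_eqF// addr_gt0 ?expR_gt0.
  have -> : expR x ^+ 2 - 1 = (expR x - 1) * (expR x + 1) by ring.
  by field; rewrite E0 E1 E2.
move=> /(expands_near prod_eq) /expands_unique /(_ (@expands_id R)) /(_ (2 * n + 1)%N).
rewrite (_ : (2 * n + 1 == 1)%N = (n == 0)%N); last by apply/eqP/eqP; lia.
move=> <-; pose F i := (2 - 2 ^+ i) * B i / i`!%:R *
  (if odd (2 * n + 1 - i) then ((2 * n + 1 - i)`!%:R)^-1 else 0).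
transitivity (\sum_(i < 2 * n.+1) F i); last by rewrite (_ : 2 * n.+1 = (2 * n + 1).+1)%N//; lia.
rewrite big_ord_odd_even {}/F.
rewrite [X in _ = _ + X]big1 ?addr0; last first.
  by move=> j _; rewrite ifF ?mulr0//; lia.
apply: eq_bigr => j _; have jn := ltn_ord j; rewrite ifT; last by lia.
by congr (_ * _ `!%:R^-1); lia.
Unshelve. all: by end_near. Qed.

(** * Truncated multiple zeta values *)

(** The outer sum is over the largest summation index [m.+1], at most N; the next ones are then at
    most [m], so the inner sum is a truncation of the same kind. *)
Fixpoint mzv_trunc {R : realType} (s : seq nat) (N : nat) : R :=
  if s is e :: s' then \sum_(m < N) m.+1%:R ^- e * mzv_trunc s' m else 1.

Lemma mzv_trunc_ge0 (R : realType) (s : seq nat) (N : nat) : 0 <= mzv_trunc s N :> R.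
Proof.
elim: s N => [|e s IH] N //=; apply: sumr_ge0 => m _.
by rewrite mulr_ge0// invr_ge0 exprn_ge0.
Qed.

Lemma mzv_trunc_ndecr (R : realType) (s : seq nat) (N : nat) :
  mzv_trunc s N <= mzv_trunc s N.+1 :> R.
Proof.
case: s => [|e s] //=; rewrite big_ord_recr/= lerDl.
by rewrite mulr_ge0 ?mzv_trunc_ge0// invr_ge0 exprn_ge0.
Qed.

(** Putting the strict bound [N.+1] in front of the chain subjects the head to the same condition as
    the later entries, so removing the head [i.+1] leaves [decr_tuples k i]. *)
Definition decr_tuples (k N : nat) : set (k.-tuple nat) :=
  [set m | path gtn N.+1 m /\ all (ltn 0) m].
Arguments decr_tuples : clear implicits.

(** The factor c is there for the induction: it absorbs the power of the head, so that the inner sum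
    is again an instance of the statement. *)
Lemma esum_mzv_trunc (R : realType) (k : nat) (s : k.-tuple nat) (N : nat) (c : R) :
  0 <= c ->
  \esum_(m in decr_tuples k N) (c * \prod_(j < k) (tnth m j)%:R ^- tnth s j)%:E =
  (c * mzv_trunc s N)%:E.
Proof.
elim: k s N c => [|k IH] s N c c0.
  rewrite (_ : decr_tuples 0 N = [set [tuple]]); last first.
    by apply/seteqP; split=> [m _|m ->]; rewrite ?(tuple0 m)//=; split.
  by rewrite esum_set1 ?big_ord0 ?tuple0//= lee_fin mulr1.
case/tupleP: s => e s.
pose h (p : nat * k.-tuple nat) : k.+1.-tuple nat := [tuple of p.1.+1 :: p.2].
have hbij : set_bij (`I_N `*`` (fun i => decr_tuples k i)) (decr_tuples k.+1 N) h.
  split.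
  - by move=> [i t] [/= iN [pt at0]]; split; rewrite /= ?ltnS ?iN.
  - move=> [i t] [i' t'] _ _ /= /(congr1 val) [-> tt'].
    by congr pair; apply: val_inj.
  - move=> m [+ +]; case/tupleP: m => -[//|i] t /= /andP[iN pt] at0.
    by exists (i, t).
rewrite (@reindex_esum _ _ _ _ _ h _ hbij).
rewrite -(@esum_esum _ _ _ `I_N (fun i => decr_tuples k i)
  (fun i t => (c * \prod_(j < k.+1) (tnth (h (i, t)) j)%:R ^- tnth [tuple of e :: s] j)%:E)); last first.
  by move=> i t _ _; rewrite lee_fin mulr_ge0// prodr_ge0.
rewrite (@eq_esum _ _ _ _ (fun i : nat => (c * i.+1%:R ^- e * mzv_trunc s i)%:E)); last first.
  move=> i _; rewrite -IH; last by rewrite mulr_ge0// invr_ge0 exprn_ge0.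
  apply: eq_esum => t _; congr _%:E; rewrite big_ord_recl !tnth0 mulrA; congr (_ * _).
  by apply: eq_bigr => j _; rewrite !tnthS.
rewrite -[`I_N]set_mem_set esum_fset; first last.
- by move=> i _; rewrite lee_fin mulr_ge0 ?mzv_trunc_ge0// mulr_ge0// invr_ge0 exprn_ge0.
- by rewrite set_mem_set.
rewrite set_mem_set -fsbig_ord sumEFin big_distrr; congr _%:E.
by apply: eq_bigr => i _; rewrite /= mulrA.
Qed.

Lemma mzv_trunc_cvg (R : realType) (k : nat) (s : k.-tuple nat) :
  (fun N => (mzv_trunc s N)%:E) @ \oo --> multizeta R s.
Proof.
pose F (m : k.-tuple nat) : \bar R := (\prod_(j < k) (tnth m j)%:R ^- tnth s j : R)%:E.
have truncE N : (mzv_trunc s N)%:E = \esum_(m in decr_tuples k N) F m.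
  rewrite -[mzv_trunc s N]mul1r -esum_mzv_trunc//.
  by apply: eq_esum => m _; rewrite mul1r.
rewrite (_ : multizeta R s = ereal_sup (range (fun N => (mzv_trunc s N)%:E))).
  apply: ereal_nondecreasing_cvgn; apply/nondecreasing_seqP => N.
  by rewrite lee_fin mzv_trunc_ndecr.
apply/eqP; rewrite eq_le; apply/andP; split.
  apply: ge_ereal_sup => _ [X [finX XD] <-].
  (* A decreasing tuple is bounded by its head, so a finite set of them lies below one truncation;
     the default 0 serves the empty tuple. *)
  pose N := (\max_(m <- finmap.enum_fset (fset_set X)) head 0 m)%N.
  apply: (@le_trans _ _ (mzv_trunc s N)%:E); last by apply: ereal_sup_ubound; exists N.
  rewrite truncE; apply: ereal_sup_ubound; exists X => //; split=> // m Xm.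
  have [sm m0] := XD _ Xm; split=> //.
  have : (head 0 m <= N)%N.
    by apply: leq_bigmax_seq => //; rewrite in_fset_set// inE.
  by case: (tval m) sm => //= i t -> /[!ltnS] ->.
apply: ge_ereal_sup => _ [N _ <-]; rewrite truncE.
apply: ge_ereal_sup => _ [X [finX XD] <-]; apply: ereal_sup_ubound; exists X => //.
split=> // m /XD[pm m0]; split=> //; exact: path_sorted pm.
Qed.

(** * Truncated sums over even arguments *)

(* Truncation of the sum of all zeta(2 e_1, ..., 2 e_k) with e_1 + ... + e_k = n. *)
Fixpoint evsum {R : realType} (k n N : nat) : R :=
  if k is k'.+1 then
    \sum_(m < N) \sum_(j < n) inv_sqr m ^+ j.+1 * evsum k' (n - j.+1) m
  else (n == 0)%:R.

(** Admitting the index N adds the geometric series ct/(1 - ct) times the sum of depth k;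
    multiplying by 1 - ct leaves just ct. *)
Lemma evsum_step (R : realType) (k n N : nat) (g := fun i => evsum k.+1 i N.+1 : R)
    (g0 := fun i => evsum k.+1 i N) (c := inv_sqr N) :
  g n - c * shift g n = g0 n - c * shift g0 n + c * shift (fun i => evsum k i N) n.
Proof.
have gE i : g i = g0 i + \sum_(j < i) c ^+ j.+1 * evsum k (i - j.+1) N.
  by rewrite /g /g0 /= big_ord_recr.
case: n => [|n]; first by rewrite gE big_ord0 /= !mulr0 !addr0.
rewrite /= !gE big_ord_recl /= subn1 /= expr1.
have -> : \sum_(j < n) c ^+ (bump 0 j).+1 * evsum k (n.+1 - (bump 0 j).+1) N =
    c * \sum_(j < n) c ^+ j.+1 * evsum k (n - j.+1) N.
  by rewrite big_distrr; apply: eq_bigr => j _; rewrite /= exprS mulrA.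
by ring.
Qed.

(* This is the coefficient of s^k t^n in
   prod_m (1 - t/m^2) * prod_m (1 + s (t/m^2) / (1 - t/m^2))
   = prod_m (1 - (1 - s) t/m^2). *)
Lemma conv_elsym_evsum (R : realType) (k n N : nat) :
  conv (fun i => (-1) ^+ i * elsym (@inv_sqr R) N i) (fun i => evsum k i N) n =
  (-1) ^+ (n + k) * 'C(n, k)%:R * elsym inv_sqr N n.
Proof.
elim: N k n => [|N IH] k n.
  rewrite (@eq_conv _ _ (fun i => (i == 0)%:R) _ (fun i => evsum k i 0)) //; last first.
    by case=> [|i] _ //=; rewrite ?mulr0 ?expr0 ?mulr1.
  rewrite conv1; case: k => [|k] /=; case: n => [|n] /=; rewrite ?big_ord0 ?mulr0 ?mulr1//.
case: k => [|k].
  by rewrite convC conv1 addn0 bin0 mulr1.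
pose E i := (-1) ^+ i * elsym (@inv_sqr R) N i; pose c : R := inv_sqr N.
pose g i : R := evsum k.+1 i N.+1; pose g0 i : R := evsum k.+1 i N.
pose g1 i : R := evsum k i N.
have convE_r f i : conv E (fun i => f i - c * shift f i) i = conv E f i - c * shift (conv E f) i.
  rewrite convC -mulNr -(convC f) -conv_shiftr (convC E) -convZl -convDl.
  by apply: eq_conv => // j _; rewrite mulNr.
(* The new factor 1 - ct of the product is moved from the symmetric functions onto [g], where
   [evsum_step] applies. *)
transitivity (conv E (fun i => g i - c * shift g i) n).
  rewrite convE_r -conv_shiftl -mulNr -convZl -convDl.
  apply: eq_conv => // -[|i] _ /=; first by rewrite /E elsym0 mulr0 addr0.
  by rewrite /E -/c exprS; ring.
rewrite (@eq_conv _ E E _ (fun i => (g0 i - c * shift g0 i) + c * shift g1 i))//; last first.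
  by move=> i _; exact: evsum_step.
rewrite convC convDl convZl !(convC _ E) convE_r conv_shiftr.
case: n => [|n] /=; rewrite !IH.
  by rewrite bin_small//; ring.
by rewrite binS natrD !addnS !addSn !exprS -/c; ring.
Qed.

Lemma big_tuple_cons (V : nmodType) (T : finType) (k : nat) (P : pred (k.+1.-tuple T))
    (F : k.+1.-tuple T -> V) :
  \sum_(s | P s) F s =
  \sum_(e : T) \sum_(t : k.-tuple T | P [tuple of e :: t]) F [tuple of e :: t].
Proof.
rewrite pair_big_dep (reindex (fun p : T * k.-tuple T => [tuple of p.1 :: p.2])) //=.
exists (fun s => (thead s, [tuple of behead s])) => [[e t] _|s _].
  by congr pair; apply: val_inj.
by rewrite [RHS]tuple_eta.
Qed.

Lemma sum_even_pos (V : nmodType) (K n : nat) (F : nat -> V) : (2 * n < K)%N ->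
  \sum_(e < K | [&& 0 < e, ~~ odd e & e <= 2 * n]%N) F e = \sum_(j < n) F (2 * j.+1)%N.
Proof.
move=> nK.
rewrite (eq_bigl (fun e : 'I_K => ((0 < e) && ~~ odd e)%N && (e < (2 * n).+1)%N)); last first.
  by move=> e; rewrite -andbA ltnS.
rewrite -(@big_ord_widen_cond _ _ _ _ _ (fun e => (0 < e) && ~~ odd e)%N F nK).
rewrite big_mkcond big_ord_recl /= add0r.
rewrite (big_ord_odd_even (fun i => if (0 < bump 0 i)%N && ~~ odd (bump 0 i) then F (bump 0 i) else 0)).
rewrite big1 ?add0r; last by move=> j _; rewrite ifF// /bump; lia.
by apply: eq_bigr => j _; rewrite ifT ?/bump; [congr F; lia|lia].
Qed.

(** The bound K is kept apart from 2n because the induction lowers n while the index type has to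
    stay fixed. *)
Lemma even_mzv_truncE (R : realType) (K k n N : nat) : (2 * n < K)%N ->
  \sum_(s : k.-tuple 'I_K |
      all (fun i : 'I_K => (0 < i)%N && ~~ odd i) s && (\sum_(j < k) tnth s j == 2 * n)%N)
    mzv_trunc (map_tuple val s) N = evsum k n N :> R.
Proof.
elim: k n N => [|k IH] n N nK.
  rewrite (eq_bigl (fun s : 0.-tuple 'I_K => n == 0)%N); last first.
    by move=> s; rewrite (tuple0 s) big_ord0 /=; apply/eqP/eqP; lia.
  case: n nK => [|n] nK /=; last by rewrite big_pred0.
  by rewrite (big_pred1 [tuple]) => [//|s]; apply/esym/eqP; rewrite (tuple0 s).
rewrite big_tuple_cons /=.
under eq_bigr do rewrite exchange_big /=.
rewrite exchange_big /=; apply: eq_bigr => m _.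
pose G e : R := m.+1%:R ^- e * evsum k (n - e./2) m.
transitivity (\sum_(e < K | [&& 0 < e, ~~ odd e & e <= 2 * n]%N) G e); last first.
  rewrite sum_even_pos//; apply: eq_bigr => j _.
  by rewrite /G /inv_sqr mul2n doubleK -mul2n exprM exprVn.
rewrite [RHS]big_mkcond; apply: eq_bigr => e _.
case: ifPn => [/and3P[e0 ev en]|He]; last first.
  rewrite big_pred0// => s; apply/negbTE; apply: contra He.
  rewrite big_ord_recl tnth0 => /andP[/andP[/andP[-> ->] _] /eqP <-].
  by rewrite leq_addr.
rewrite /G -IH; last by lia.
rewrite big_distrr /=; apply: eq_bigl => s.
rewrite e0 ev /=; congr (_ && _); rewrite big_ord_recl tnth0.
rewrite [X in (e + X)%N](eq_bigr (fun i => nat_of_ord (tnth s i))); last first.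
  by move=> i _; rewrite !(tnth_nth e).
have : (e = 2 * e./2 :> nat)%N by rewrite mul2n even_halfK.
by move=> eE; apply/eqP/eqP; lia.
Qed.

(** * Passage to the limit and closed form *)

(** Solving [conv_elsym_evsum] for its term with e_0 = 1 expresses [evsum k n] through smaller
    weights, so convergence follows by strong induction. The stated limit obeys the same recursion,
    because [eta] and [E] are inverse: they list the coefficients in t of x / sin x and sin x / x at
    x^2 = pi^2 t. *)
Lemma evsum_cvg (R : realType) (B : nat -> R) (k n : nat) : is_bernoulli B ->
  evsum k n @ \oo -->
  conv (fun i => (-1) ^+ i * pi ^+ (2 * i) * ((2 - 2 ^+ (2 * i)) * B (2 * i)%N / (2 * i)`!%:R))
       (fun j => (-1) ^+ (j + k) * 'C(j, k)%:R * zeta2 j) n.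
Proof.
move=> hB; set eta := fun i => _ * (_ / _); set al := fun j => _ * zeta2 j.
pose E i : R := (-1) ^+ i * zeta2 i.
have Eeta : conv E eta =1 (fun n => (n == 0)%:R).
  move=> m; rewrite -(conv_bernoulli m hB) (convC E).
  (* The scalar is 1 at m = 0 and multiplies 0 elsewhere. *)
  transitivity ((-1) ^+ m * pi ^+ (2 * m) * conv
    (fun i => (2 - 2 ^+ (2 * i)) * B (2 * i)%N / (2 * i)`!%:R)
    (fun j => ((2 * j + 1)`!%:R)^-1) m); last first.
    by rewrite conv_bernoulli//; case: m => [|m]; rewrite ?mulr0// muln0 !expr0 !mulr1.
  rewrite /conv big_distrr /=; apply: eq_bigr => i _.
  have im : (i <= m)%N by rewrite -ltnS.
  have -> : (-1) ^+ m * pi ^+ (2 * m) =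
      ((-1) ^+ i * pi ^+ (2 * i)) * ((-1) ^+ (m - i) * pi ^+ (2 * (m - i))) :> R.
    by rewrite mulrACA -!exprD -mulnDr subnKC.
  by rewrite /eta /E /zeta2; ring.
have Eom m : conv E (conv eta al) m = al m.
  by rewrite convA (eq_conv (fun i _ => Eeta i) (fun i _ => erefl (al i))) conv1.
elim/ltn_ind: n => n IH.
have -> : conv eta al n = al n - \sum_(i < n) E i.+1 * conv eta al (n - i.+1).
  rewrite -[al n]Eom [in RHS]/conv big_ord_recl subn0 addrK.
  by rewrite /E /zeta2 muln0 !expr0 (_ : (0 + 1)`! = 1)%N// divr1 !mul1r.
have -> : evsum k n = fun N => (-1) ^+ (n + k) * 'C(n, k)%:R * elsym inv_sqr N n -
    \sum_(i < n) ((-1) ^+ i.+1 * elsym (@inv_sqr R) N i.+1) * evsum k (n - i.+1) N.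
  apply/funext => N; rewrite -conv_elsym_evsum /conv big_ord_recl subn0 addrK.
  by rewrite elsym0 expr0 !mul1r.
apply: cvgB.
  by apply: cvgM (cvg_cst _) _; exact: elsym_inv_sqr_cvg.
apply: cvg_big => [|i _]; first exact: add_continuous.
apply: cvgM; last by apply: IH; rewrite ltn_subrL/=; case: n i => [[]|].
by apply: cvgM (cvg_cst _) _; exact: elsym_inv_sqr_cvg.
Qed.

Lemma even_multizeta_sum_cvg (R : realType) (k n : nat) :
  (fun N => (evsum k n N : R)%:E) @ \oo --> even_multizeta_sum R (2 * n) k.
Proof.
rewrite (_ : (fun N => _) = fun N => (\sum_(s : k.-tuple 'I_(2 * n).+1 |
    all (fun i : 'I_(2 * n).+1 => (0 < i)%N && ~~ odd i) s &&
    (\sum_(j < k) tnth s j == 2 * n)%N) (mzv_trunc (map_tuple val s) N : R)%:E)%E).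
  by apply: cvg_nnesum => s _; [near=> N; rewrite lee_fin mzv_trunc_ge0|exact: mzv_trunc_cvg].
by apply/funext => N; rewrite sumEFin even_mzv_truncE.
Unshelve. all: by end_near. Qed.

Lemma even_sum_closed_form (R : realType) (B : nat -> R) (n k : nat) : (k <= n)%N ->
  conv (fun i => (-1) ^+ i * pi ^+ (2 * i) * ((2 - 2 ^+ (2 * i)) * B (2 * i)%N / (2 * i)`!%:R))
       (fun j => (-1) ^+ (j + k) * 'C(j, k)%:R * zeta2 j) n =
  (-1) ^ (n%:Z - k%:Z - 1) * pi ^+ (2 * n) / ((2 * n + 1)`!)%:R *
   \sum_(0 <= i < (n - k).+1)
      'C(n - i, k)%:R * 'C(2 * n + 1, 2 * i)%:R *
      (2 * (2 ^ ((2 * i)%:Z - 1) - 1) * B (2 * i)%N).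
Proof.
move=> kn; rewrite big_mkord.
pose F i : R := (-1) ^+ i * pi ^+ (2 * i) * ((2 - 2 ^+ (2 * i)) * B (2 * i)%N / (2 * i)`!%:R) *
  ((-1) ^+ (n - i + k) * 'C(n - i, k)%:R * zeta2 (n - i)).
rewrite -[LHS]/(\sum_(i < n.+1) F i).
have nkn : ((n - k).+1 <= n.+1)%N by rewrite ltnS leq_subr.
(* For i > n - k the binomial C(n-i, k) is zero. *)
transitivity (\sum_(i < (n - k).+1) F i).
  rewrite (big_ord_widen _ F nkn) [in RHS]big_mkcond; apply: eq_bigr => i _.
  case: ifPn => //; rewrite -leqNgt => nki; have ilen := ltn_ord i; rewrite /F bin_small; last by lia.
  by ring.
rewrite big_distrr; apply: eq_bigr => i _ /=; have ink : (i <= n - k)%N by rewrite -ltnS.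
have in_ : (i <= n)%N by rewrite (leq_trans ink)// leq_subr.
(* The integer exponent equals -1 when n = k; modulo 2 it is n + k + 1. *)
have sgn : (-1) ^ (n%:Z - k%:Z - 1) = - ((-1) ^+ i * (-1) ^+ (n - i + k)) :> R.
  rewrite -exprD addnA subnKC// subzn// expfzDr ?oppr_eq0 ?oner_eq0//.
  rewrite -exprnP exprN1 invrN1 mulrN1; congr (- _).
  rewrite (_ : n + k = n - k + 2 * k)%N; last by lia.
  by rewrite exprD exprM sqrrN !expr1n mulr1.
have pow2 : 2 * (2 ^ ((2 * i)%:Z - 1) - 1) = 2 ^+ (2 * i) - 2 :> R.
  by rewrite expfzDr ?pnatr_eq0// -exprnP exprN1 mulrBr mulr1 mulrCA divff ?mulr1 ?pnatr_eq0.
have binE : ((2 * n + 1)`!%:R)^-1 * 'C(2 * n + 1, 2 * i)%:R =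
    ((2 * i)`!%:R)^-1 * ((2 * (n - i) + 1)`!%:R)^-1 :> R.
  have f0 m : m`!%:R != 0 :> R by rewrite pnatr_eq0 -lt0n fact_gt0.
  have le_in : (2 * i <= 2 * n + 1)%N by lia.
  rewrite -(bin_fact le_in) (_ : 2 * n + 1 - 2 * i = 2 * (n - i) + 1)%N; last by lia.
  have b0 : 'C(2 * n + 1, 2 * i)%:R != 0 :> R by rewrite pnatr_eq0 -lt0n bin_gt0.
  rewrite !natrM; move: b0 (f0 (2 * i)%N) (f0 (2 * (n - i) + 1)%N).
  move: (_%:R) (_%:R) (_%:R) => x y z y0 x0 z0.
  by field; rewrite x0 y0 z0.
have piE : pi ^+ (2 * n) = pi ^+ (2 * i) * pi ^+ (2 * (n - i)) :> R.
  by rewrite -exprD -mulnDr subnKC.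
rewrite sgn pow2 piE /F /zeta2.
transitivity (- ((-1) ^+ i * (-1) ^+ (n - i + k)) * (pi ^+ (2 * i) * pi ^+ (2 * (n - i))) *
  (((2 * i)`!%:R)^-1 * ((2 * (n - i) + 1)`!%:R)^-1) *
  ('C(n - i, k)%:R * ((2 ^+ (2 * i) - 2) * B (2 * i)%N)) : R).
  by ring.
by rewrite -binE; ring.
Qed.

Theorem theorem3 (R : realType) (B : nat -> R) (hB : is_bernoulli B)
    (n k : nat) (hk : (1 <= k <= n)%N) :
  even_multizeta_sum R (2 * n) k =
  ((-1) ^ (n%:Z - k%:Z - 1) * pi ^+ (2 * n) / ((2 * n + 1)`!)%:R *
   \sum_(0 <= i < (n - k).+1)
      'C(n - i, k)%:R * 'C(2 * n + 1, 2 * i)%:R *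
      (2 * (2 ^ ((2 * i)%:Z - 1) - 1) * B (2 * i)%N))%:E.
Proof.
have /andP[_ kn] := hk; rewrite -even_sum_closed_form//.
apply: cvg_unique (@even_multizeta_sum_cvg R k n) _ => //.
by apply: cvg_EFin; [near=> N|exact: evsum_cvg].
Unshelve. all: by end_near. Qed.
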